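(* Consider the stable dynamics model, an equilibrium $(f^*,t^* )$ and $R=\|t^*-\bar t\|_2$. Let $\varepsilon>0$ and let the universal method of similar triangles (UMST) be run with accuracy $\varepsilon$ and initial parameter $0<L_0\le\frac{4M^2}{\varepsilon}$, producing $t^N,\hat f^N$. Then after at most $$N_Q=4\left(\frac{RM}{\varepsilon}\right)^2$$ iterations of UMST it holds that $Q(t^N)-Q(t^* )\le\varepsilon$. Moreover, let $g\in\{\Theta x:x\in X\}$ be such that $\xi=1-\max_{e\in E}g_e/\bar f_e>0$, and let $\pi$ be the associated map to admissible flows. Then the stopping criterion $$Q(t^N)+\Psi(\pi(\hat f^N))\le\varepsilon$$ is fulfilled after at most $$N_{stop}=O\left(\left(\frac{RM}{\varepsilon}\right)^2\max\left\{1,\ \left(\frac{\langle g-f^*,\bar t\rangle}{\xi R\min_e\bar f_e}\right)^2\right\}\right)$$ iterations, where $O(\cdot)$ hides an absolute constant (for this second bound $R>0$, so that the expression is defined).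
   Context: Network. $G=(V,E)$ is a finite directed graph. $OD$ is a finite set of origin-destination pairs $w=(i,j)$ of vertices, with demands $d_w\ge 0$. $P_w$ is the (nonempty) set of simple paths from $i$ to $j$ for $w=(i,j)$, and $P=\bigcup_{w\in OD}P_w$. $X=\{x\in\mathbb R_+^{|P|}:\sum_{p\in P_w}x_p=d_w,\ w\in OD\}$. $\Theta$ is the $|E|\times|P|$ matrix with $\Theta_{e,p}=1$ if $e\in p$ and $0$ otherwise. Each edge $e$ has free flow time $\bar t_e>0$ and capacity $\bar f_e>0$. For $t\in\mathbb R_+^{|E|}$: $T_p(t)=\sum_{e\in p}t_e$, $T_w(t)=\min_{p\in P_w}T_p(t)$. Vector inequalities are componentwise. Stable dynamics model. $\Phi(t)=-\sum_{w\in OD}d_wT_w(t)$, $h(t)=\langle t-\bar t,\bar f\rangle$ with $\operatorname{dom}h=\{t: t\ge\bar t\}$, and $Q(t)=\Phi(t)+h(t)$ is to be minimized over $t\ge\bar t$ (dual problem). The primal objective is $\Psi(f)=\sum_{e\in E}f_e\bar t_e$, to be minimized over $f\in\{\Theta x:x\in X\}$ with $f\le\bar f$. An equilibrium $(f^*,t^* )$ (assumed to exist) is a solution of the saddle-point problem $\min_{f\in\{\Theta x:x\in X\}}\max_{t\ge\bar t}\sum_{e\in E}[t_ef_e-(t_e-\bar t_e)\bar f_e]$; in particular $t^*$ minimizes $Q$ and $f^*$ solves the primal problem. Subgradients. $\partial\Phi(t)=-\sum_{w\in OD}d_w\,\mathrm{Conv}\{a_p:p\in P_w,\ T_p(t)=T_w(t)\}$,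 where $a_p\in\{0,1\}^{|E|}$ is the indicator vector of the edges of $p$. $\nabla\Phi(t)$ denotes an arbitrary (chosen) element of $\partial\Phi(t)$. Constant $M$. $M=\sqrt{2H}\sum_{w\in OD}d_w$, where $H$ is the diameter of $G$; $M$ comes with the bound $\|\nabla\Phi(t_1)-\nabla\Phi(t_2)\|_2\le M$ for all $t_1,t_2\in\mathbb R_+^{|E|}$ and all choices of subgradients. UMST. Input $L_0>0$, $\varepsilon>0$. Set $u^0=t^0=\bar t$, $A_0=0$, $\phi_0(t)=\frac12\|t-t^0\|_2^2$. For $k=0,1,2,\dots$: set $L_{k+1}:=L_k/2$; repeat: compute $$\alpha_{k+1}=\frac1{2L_{k+1}}+\sqrt{\frac1{4L_{k+1}^2}+\frac{A_k}{L_{k+1}}},\quad A_{k+1}=A_k+\alpha_{k+1},\quad y^{k+1}=\frac{\alpha_{k+1}u^k+A_kt^k}{A_{k+1}},$$ $$\phi_{k+1}(t)=\phi_k(t)+\alpha_{k+1}\left[\Phi(y^{k+1})+\langle\nabla\Phi(y^{k+1}),t-y^{k+1}\rangle+h(t)\right],$$ $$u^{k+1}=\arg\min_{t\in\operatorname{dom}h}\phi_{k+1}(t),\quad t^{k+1}=\frac{\alpha_{k+1}u^{k+1}+A_kt^k}{A_{k+1}};$$ if $\Phi(t^{k+1})\le\Phi(y^{k+1})+\langle\nabla\Phi(y^{k+1}),t^{k+1}-y^{k+1}\rangle+\frac{L_{k+1}}2\|t^{k+1}-y^{k+1}\|_2^2+\frac{\alpha_{k+1}}{2A_{k+1}}\varepsilon$,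 accept all these quantities and go to the next $k$; otherwise replace $L_{k+1}$ by $2L_{k+1}$ and repeat. ''Iterations'' counts the outer index $k$. After $N\ge1$ iterations, $\hat f^N=-\frac1{A_N}\sum_{k=1}^N\alpha_k\nabla\Phi(y^k)$. Map $\pi$. Given $g$ and $\xi$ as in the claim, for $f\in\{\Theta x:x\in X\}$ let $\eta=\max_{e\in E}f_e/\bar f_e-1$; then $\pi(f)=f$ if $\eta\le0$ and $\pi(f)=\frac{\xi f+\eta g}{\xi+\eta}$ if $\eta>0$. Convention: a property ''holds after at most $K$ iterations'' means that it holds for some integer $N$ with $1\le N\le\max\{1,\lceil K\rceil\}$. *)

(* Defs.v *)
From HB Require Import structures.
From mathcomp Require Import all_boot all_order all_algebra.
From mathcomp Require Import reals.

Set Implicit Arguments.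
Unset Strict Implicit.
Unset Printing Implicit Defensive.

Import Order.TTheory GRing.Theory Num.Theory.
Local Open Scope ring_scope.

(* Extrema over a nonempty finite set; the value on the empty set is junk. *)
Definition fin_min (R : realType) (I : finType) (A : {set I}) (F : I -> R) : R :=
  if [pick a in A] is Some a then \big[Num.min/F a]_(i in A) F i else 0.

Definition fin_max (R : realType) (I : finType) (A : {set I}) (F : I -> R) : R :=
  if [pick a in A] is Some a then \big[Num.max/F a]_(i in A) F i else 0.

(* Vectors of R^|I|; R^o is R seen as a module over itself, which makes vec R I
   an R-module. *)
Notation vec R I := {ffun I -> R^o}.

Definition inner (R : realType) (I : finType) (u v : vec R I) : R :=
  \sum_i (u i : R) * v i.

Definition l2norm (R : realType) (I : finType) (v : vec R I) : R :=
  Num.sqrt (\sum_i (v i : R) ^+ 2).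

Definition vle (R : realType) (I : finType) (u v : vec R I) : Prop :=
  forall i, (u i : R) <= v i.

Definition in_conv (R : realType) (I J : finType) (A : {set I})
    (a : I -> vec R J) (c : vec R J) : Prop :=
  exists lam : I -> R,
    [/\ forall i, i \in A -> 0 <= lam i,
        \sum_(i in A) lam i = 1
      & c = \sum_(i in A) lam i *: a i].

Definition is_argmin (R : realType) (T : Type) (D : T -> Prop) (F : T -> R)
    (x : T) : Prop :=
  D x /\ forall z, D z -> F x <= F z.

(* "P holds after at most K iterations" *)
Definition holds_within (R : realType) (K : R) (P : nat -> Prop) : Prop :=
  exists N : nat,
    [/\ (1 <= N)%N, (N%:Z <= Num.max 1 (Num.ceil K))%R & P N].

(* Finite directed graphs; parallel edges are allowed. *)
Record digraph := Digraph {
  vertex : finType;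
  edge : finType;
  source : edge -> vertex;
  target : edge -> vertex }.

Section Paths.
Variable G : digraph.

Fixpoint walk (i : vertex G) (s : seq (edge G)) (j : vertex G) : bool :=
  if s is e :: s' then (source e == i) && walk (target e) s' j else i == j.

(* A path is its origin together with its list of edges (the origin tells
   apart the empty paths at different vertices).  A simple path has fewer than
   #|V| edges, so bounding the length by #|V| loses none of them and makes the
   type of paths finite. *)
Definition gpath : finType :=
  (vertex G * {bseq #|vertex G| of edge G})%type.

Definition pedges (p : gpath) : seq (edge G) := p.2.

Definition simple_paths (w : vertex G * vertex G) : {set gpath} :=
  [set p : gpath | [&& p.1 == w.1, walk w.1 (pedges p) w.2
                     & uniq (w.1 :: map (@target G) (pedges p))]].

(* Number of edges of a shortest path; every simple path is shorter than the
   default value #|V|, which is thus only taken by unreachable pairs. *)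
Definition gdist (w : vertex G * vertex G) : nat :=
  \big[minn/#|vertex G|]_(p in simple_paths w) size (pedges p).

(* Largest distance, over the pairs at finite distance. *)
Definition diameter : nat :=
  \max_(w : vertex G * vertex G | simple_paths w != set0) gdist w.

End Paths.

Record network (R : realType) := Network {
  graph : digraph;
  OD : {set vertex graph * vertex graph};
  demand : vertex graph * vertex graph -> R;
  tbar : vec R (edge graph);
  fbar : vec R (edge graph);
  demand_ge0 : forall w, w \in OD -> 0 <= demand w;
  paths_neq0 : forall w, w \in OD -> simple_paths w != set0;
  tbar_gt0 : forall e, 0 < (tbar e : R);
  fbar_gt0 : forall e, 0 < (fbar e : R) }.

Arguments demand {R} _ _.

Section StableDynamics.
Variables (R : realType) (net : network R).

Local Notation E := (edge (graph net)).
Local Notation evec := (vec R E).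
Local Notation gpath := (gpath (graph net)).
Local Notation tbar := (tbar net).
Local Notation fbar := (fbar net).

Definition OD_paths : {set gpath} := \bigcup_(w in OD net) simple_paths w.

Definition Theta (e : E) (p : gpath) : R := (e \in pedges p)%:R.

(* Path flows are indexed by all of gpath; only the coordinates in OD_paths are
   ever used. *)
Definition path_flow (x : vec R gpath) : Prop :=
  (forall p, p \in OD_paths -> 0 <= (x p : R)) /\
  (forall w, w \in OD net -> \sum_(p in simple_paths w) (x p : R) = demand net w).

Definition edge_flow (x : vec R gpath) : evec :=
  [ffun e => \sum_(p in OD_paths) Theta e p * (x p : R)].

(* f \in {Theta x : x \in X} *)
Definition is_flow (f : evec) : Prop :=
  exists x, path_flow x /\ f = edge_flow x.

Definition Tpath (t : evec) (p : gpath) : R := \sum_(e in pedges p) (t e : R).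

Definition Tmin (t : evec) (w : vertex (graph net) * vertex (graph net)) : R :=
  fin_min (simple_paths w) (Tpath t).

Definition Phi (t : evec) : R := - \sum_(w in OD net) demand net w * Tmin t w.

Definition dom_h (t : evec) : Prop := vle tbar t.

(* Meaningful on dom_h only. *)
Definition h (t : evec) : R := inner (t - tbar) fbar.

Definition Q (t : evec) : R := Phi t + h t.

Definition Psi (f : evec) : R := \sum_e (f e : R) * tbar e.

Definition lagrangian (f t : evec) : R :=
  \sum_e ((t e : R) * f e - (t e - tbar e : R) * fbar e).

Definition equilibrium (f t : evec) : Prop :=
  [/\ is_flow f, dom_h t,
      forall t', dom_h t' -> lagrangian f t' <= lagrangian f t
    & forall f', is_flow f' -> lagrangian f t <= lagrangian f' t].

Definition path_vec (p : gpath) : evec := [ffun e => Theta e p].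

Definition shortest_paths (t : evec) (w : vertex (graph net) * vertex (graph net)) :
    {set gpath} :=
  [set p in simple_paths w | Tpath t p == Tmin t w].

Definition subdiff_Phi (t v : evec) : Prop :=
  exists c : vertex (graph net) * vertex (graph net) -> evec,
    (forall w, w \in OD net -> in_conv (shortest_paths t w) path_vec (c w)) /\
    v = - \sum_(w in OD net) demand net w *: c w.

Definition subgradient_choice (nabla : evec -> evec) : Prop :=
  forall t, vle 0 t -> subdiff_Phi t (nabla t).

Definition Mconst : R :=
  Num.sqrt (2 * (diameter (graph net))%:R) * \sum_(w in OD net) demand net w.

Definition subgradient_bound : Prop :=
  forall t1 t2 v1 v2, vle 0 t1 -> vle 0 t2 ->
    subdiff_Phi t1 v1 -> subdiff_Phi t2 v2 -> l2norm (v1 - v2) <= Mconst.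

Section UMST.
Variables (nabla : evec -> evec) (L0 eps : R).

Record umst_state := UmstState {
  L_ : R;
  alpha_ : R;
  A_ : R;
  y_ : evec;
  phi_ : evec -> R;
  u_ : evec;
  t_ : evec }.

(* alpha and y have no value at k = 0; the ones given here are never read. *)
Definition umst_init : umst_state :=
  UmstState L0 0 0 tbar (fun t => l2norm (t - tbar) ^+ 2 / 2) tbar tbar.

Definition linearization (y t : evec) : R := Phi y + inner (nabla y) (t - y).

(* s' holds the quantities computed from the k-th state s when the value L is
   tried for L_{k+1}. *)
Definition umst_trial (s : umst_state) (L : R) (s' : umst_state) : Prop :=
  L_ s' = L /\
  alpha_ s' = (2 * L)^-1 + Num.sqrt ((4 * L ^+ 2)^-1 + A_ s / L) /\
  A_ s' = A_ s + alpha_ s' /\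
  y_ s' = (A_ s')^-1 *: (alpha_ s' *: u_ s + A_ s *: t_ s) /\
  phi_ s' = (fun t => phi_ s t + alpha_ s' * (linearization (y_ s') t + h t)) /\
  is_argmin dom_h (phi_ s') (u_ s') /\
  t_ s' = (A_ s')^-1 *: (alpha_ s' *: u_ s' + A_ s *: t_ s).

Definition umst_accept (s' : umst_state) : bool :=
  Phi (t_ s') <= linearization (y_ s') (t_ s')
                 + L_ s' / 2 * l2norm (t_ s' - y_ s') ^+ 2
                 + alpha_ s' / (2 * A_ s') * eps.

(* i is the number of rejected trials of the iteration. *)
Definition umst_step (s s' : umst_state) : Prop :=
  exists i : nat,
    [/\ umst_trial s (2 ^+ i * (L_ s / 2)) s',
        umst_accept s'
      & forall j : nat, (j < i)%N ->
          exists s'', umst_trial s (2 ^+ j * (L_ s / 2)) s'' /\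
                      ~~ umst_accept s''].

Definition umst_run (S : nat -> umst_state) : Prop :=
  S 0%N = umst_init /\ forall k, umst_step (S k) (S k.+1).

Definition fhat (S : nat -> umst_state) (N : nat) : evec :=
  - ((A_ (S N))^-1 *:
       \sum_(1 <= k < N.+1) alpha_ (S k) *: nabla (y_ (S k))).

End UMST.

Definition max_load (f : evec) : R := fin_max [set: E] (fun e => (f e : R) / fbar e).

Definition slack (g : evec) : R := 1 - max_load g.

Definition excess (f : evec) : R := max_load f - 1.

Definition proj_admissible (g f : evec) : evec :=
  if excess f <= 0 then f
  else (slack g + excess f)^-1 *: (slack g *: f + excess f *: g).

Definition min_capacity : R := fin_min [set: E] (fun e => fbar e : R).

End StableDynamics.

(* Main.v *)
(* Phi is positively homogeneous and convex, so Phi(y) = <grad, y> at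
   every y and each linearization is the linear form <grad Phi(y_k), .>.  Hence
   phi_N(t) = |t - tbar|^2 / 2 - A_N <fhat, t> + A_N h(t), and the similar
   triangles invariant A_N Q(t_N) <= min phi_N + A_N eps / 2 gives both the dual
   rate |t* - tbar|^2 / (2 A_N) + eps / 2 (take t = t* ) and, for every s >= 0,
     Q(t_N) + Psi(fhat) <= |s|^2 / (2 A_N) - <fhat - fbar, s> + eps / 2
   (take t = tbar + s); a well chosen s bounds the cost of repairing fhat.
   A trial is accepted as soon as alpha <= eps / M^2 and halving L at most doubles
   alpha, so with the bound on L_0 every step has alpha >= eps / (2 M^2), that is
   A_N >= N eps / (2 M^2). *)

Require Import Defs.
From mathcomp Require Import all_boot all_order all_algebra.
From mathcomp Require Import boolp reals.
From mathcomp Require Import ring lra.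
Import Order.TTheory GRing.Theory Num.Theory.
Local Open Scope ring_scope.
Set Implicit Arguments.
Unset Strict Implicit.
Unset Printing Implicit Defensive.

(** * Euclidean vectors and quadratics over an orthant *)

Section Vectors.
Variables (R : realType) (I : finType).
Implicit Types (u v w : vec R I) (a : R).

Lemma innerC u v : inner u v = inner v u.
Proof. by apply: eq_bigr => i _; rewrite mulrC. Qed.

Lemma innerDl u v w : inner (u + v) w = inner u w + inner v w.
Proof.
by rewrite -big_split; apply: eq_bigr => i _; rewrite ffunE; apply: mulrDl.
Qed.

Lemma innerZl a u w : inner (a *: u) w = a * inner u w.
Proof.
by rewrite /inner big_distrr; apply: eq_bigr => i _; rewrite ffunE; apply: esym (mulrA _ _ _).
Qed.

Lemma innerNl u w : inner (- u) w = - inner u w.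
Proof. by rewrite -scaleN1r innerZl mulN1r. Qed.

Lemma innerBl u v w : inner (u - v) w = inner u w - inner v w.
Proof. by rewrite innerDl innerNl. Qed.

Lemma innerDr u v w : inner w (u + v) = inner w u + inner w v.
Proof. by rewrite innerC innerDl !(innerC w). Qed.

Lemma innerZr a u w : inner w (a *: u) = a * inner w u.
Proof. by rewrite innerC innerZl (innerC w). Qed.

Lemma innerNr u w : inner w (- u) = - inner w u.
Proof. by rewrite innerC innerNl (innerC w). Qed.

Lemma innerBr u v w : inner w (u - v) = inner w u - inner w v.
Proof. by rewrite innerDr innerNr. Qed.

Lemma inner_suml (J : Type) (r : seq J) (P : pred J) (F : J -> vec R I) w :
  inner (\sum_(j <- r | P j) F j) w = \sum_(j <- r | P j) inner (F j) w.
Proof.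
elim/big_rec2: _ => [|j x y _ <-]; last by rewrite innerDl.
by rewrite -(scale0r 0) innerZl mul0r.
Qed.

Lemma inner_ge0 u : 0 <= inner u u.
Proof. by apply: sumr_ge0 => i _; rewrite -expr2 sqr_ge0. Qed.

Lemma l2norm_ge0 u : 0 <= l2norm u.
Proof. exact: sqrtr_ge0. Qed.

Lemma l2normE u : l2norm u ^+ 2 = inner u u.
Proof. by rewrite sqr_sqrtr // sumr_ge0 // => i _; rewrite sqr_ge0. Qed.

Lemma l2norm_sqrD u v : l2norm (u + v) ^+ 2 <= 2 * l2norm u ^+ 2 + 2 * l2norm v ^+ 2.
Proof.
have := inner_ge0 (u - v); rewrite !l2normE innerBl !innerBr !innerDl !innerDr (innerC v u).
lra.
Qed.

Lemma inner_young u v a : 0 < a ->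
  inner u v <= a / 2 * l2norm v ^+ 2 + inner u u / (2 * a).
Proof.
move=> a0; rewrite -subr_ge0.
have -> : a / 2 * l2norm v ^+ 2 + inner u u / (2 * a) - inner u v
          = inner (u - a *: v) (u - a *: v) / (2 * a).
  rewrite l2normE !(innerBl, innerBr, innerZl, innerZr) (innerC v u); field.
  by rewrite gt_eqF.
by rewrite divr_ge0 ?inner_ge0 // mulr_ge0 // ltW.
Qed.

Lemma l2normZ_sqr a u : l2norm (a *: u) ^+ 2 = a ^+ 2 * l2norm u ^+ 2.
Proof. by rewrite !l2normE innerZl innerZr mulrA. Qed.

Lemma inner_mono u v w : vle 0 w -> vle u v -> inner w u <= inner w v.
Proof.
move=> w0 uv; apply: ler_sum => i _; apply: ler_wpM2l (uv i).
by have := w0 i; rewrite ffunE.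
Qed.

Lemma vle_subr u v : vle u v <-> vle 0 (v - u).
Proof. by split=> h i; have := h i; rewrite !ffunE subr_ge0. Qed.

Lemma vle_comb u v w a b c : 0 < a -> 0 <= b -> 0 <= c -> a = b + c ->
  vle u v -> vle u w -> vle u (a^-1 *: (b *: v + c *: w)).
Proof.
move=> a0 b0 c0 abc uv uw i; rewrite !ffunE.
have: b * (u i : R) + c * u i <= b * (v i : R) + c * w i.
  by rewrite lerD // ler_wpM2l.
by rewrite -mulrDl -abc mulrC -ler_pdivlMr // mulrC.
Qed.

(** The projection of [b - G] onto the orthant [t >= b]; this explicit minimizer makes the argmin of
    each UMST trial exist without a compactness argument. *)
Definition box_min_pt (b G : vec R I) : vec R I :=
  [ffun i => Num.max (b i : R) (b i - G i)].

Lemma box_min (b G : vec R I) :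
  is_argmin (vle b) (fun t => l2norm (t - b) ^+ 2 / 2 + inner G (t - b)) (box_min_pt b G).
Proof.
split=> [i|z bz]; first by rewrite ffunE le_max lexx.
rewrite !l2normE /inner !mulr_suml -!big_split; apply: ler_sum => i _ /=.
have := bz i; rewrite !ffunE.
move: (b i : R) (G i : R) (z i : R) => x y w xw.
rewrite /Num.max; case: ifP => [?|/negbT]; first by have := sqr_ge0 (w - x + y); nra.
rewrite -leNgt => yx; have y0 : 0 <= y by lra.
have wx : 0 <= w - x by lra.
have := mulr_ge0 y0 wx; have := sqr_ge0 (w - x); nra.
Qed.

(* Comparing [u] with [u + l (z - u)] and letting [l] tend to 0 shows that the
   linear part of the quadratic is nonnegative in the direction [z - u]. *)
Lemma argmin_strong_convexity (b c G u z : vec R I) (F : vec R I -> R) (k : R) :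
  (forall t, F t = l2norm (t - b) ^+ 2 / 2 + inner G t + k) ->
  is_argmin (vle c) F u -> vle c z ->
  F u + l2norm (z - u) ^+ 2 / 2 <= F z.
Proof.
move=> FE [cu umin] cz.
pose B := inner (u - b) (z - u) + inner G (z - u).
have FEa (a : R) : F (u + a *: (z - u)) = F u + a * B + a ^+ 2 / 2 * l2norm (z - u) ^+ 2.
  rewrite !FE /B !l2normE (addrAC u).
  move: (u - b) (z - u) => p q.
  by rewrite !(innerDl, innerDr, innerZl, innerZr) (innerC q p); field.
have B0 : 0 <= B.
  rewrite leNgt; apply/negP => Bn.
  pose n := l2norm (z - u) ^+ 2; have n0 : 0 <= n by rewrite exprn_ge0 ?l2norm_ge0.
  (* One explicit [l] in []0, 1]] serves instead of a limit: [l * n <= - B], so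
     [l * B + l ^+ 2 / 2 * n] is at most [l * B / 2 < 0]. *)
  pose l := - B / (n - B).
  have nB : 0 < n - B by lra.
  have l0 : 0 < l by rewrite divr_gt0 // oppr_gt0.
  have lE : l * (n - B) = - B by rewrite divfK // gt_eqF.
  have l1 : l <= 1 by rewrite ler_pdivrMr //; lra.
  have cl : vle c (u + l *: (z - u)).
    move=> i; have := cu i; have := cz i; rewrite !ffunE /GRing.scale /=.
    move: (c i : R) (u i : R) (z i : R) => x y w ? ?; nra.
  have := umin _ cl; rewrite FEa -/n; nra.
have := FEa 1; rewrite scale1r addrCA subrr addr0 => ->; lra.
Qed.
End Vectors.

(** * Minima and maxima over finite sets *)

Section Extrema.
Variables (R : realType) (I : finType) (A : {set I}) (F : I -> R).

Lemma fin_min_le i : i \in A -> fin_min A F <= F i.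
Proof.
rewrite /fin_min; case: pickP => [a _ iA|-> //].
by rewrite (bigD1 i) //= ge_min lexx.
Qed.

Lemma fin_minP i : i \in A -> exists2 j, j \in A & fin_min A F = F j.
Proof.
rewrite /fin_min; case: pickP => [a aA iA|-> //].
apply: (big_ind (fun x => exists2 j, j \in A & x = F j)) => [|x y|j jA].
- by exists a.
- by move=> [j jA ->] [k kA ->]; rewrite /Num.min; case: ifP; [exists j|exists k].
- by exists j.
Qed.

Lemma le_fin_max i : i \in A -> F i <= fin_max A F.
Proof.
rewrite /fin_max; case: pickP => [a _ iA|-> //].
by rewrite (bigD1 i) //= le_max lexx.
Qed.

Lemma fin_maxP i : i \in A -> exists2 j, j \in A & fin_max A F = F j.
Proof.
rewrite /fin_max; case: pickP => [a aA iA|-> //].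
apply: (big_ind (fun x => exists2 j, j \in A & x = F j)) => [|x y|j jA].
- by exists a.
- by move=> [j jA ->] [k kA ->]; rewrite /Num.max; case: ifP; [exists k|exists j].
- by exists j.
Qed.
End Extrema.

(** The witness is [Num.max 1 (Num.ceil K)] itself, since the estimates of this proof hold for every
    large enough [N]. *)
Lemma holds_within_ge (R : realType) (K : R) (P : nat -> Prop) :
  (forall N : nat, (1 <= N)%N -> K <= N%:R -> P N) -> holds_within K P.
Proof.
move=> KP; set m := Num.max 1 (Num.ceil K).
have m1 : 1 <= m by rewrite le_max lexx.
have mE : `|m|%N%:Z = m by rewrite gez0_abs // (le_trans _ m1).
have N1 : (1 <= `|m|)%N by rewrite -lez_nat mE.
exists `|m|%N; split=> //; first by rewrite mE.
apply: KP => //; apply: le_trans (ceil_ge K) _.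
by rewrite pmulrn mE ler_int le_max lexx orbT.
Qed.

(** * Paths of the graph *)

Section Paths.
Variable G : digraph.

Lemma walk_inj i j k (s : seq (edge G)) : walk i s j -> walk i s k -> j = k.
Proof.
elim: s i => [|e s IH] i /=; first by move=> /eqP <- /eqP.
by move=> /andP[_ /IH h] /andP[_ /h].
Qed.

(** Origin and edge list determine the endpoint. Distinct pairs thus have disjoint path sets, and
    flows of different pairs can be merged into one path flow. *)
Lemma simple_paths_inj (p : gpath G) w w' :
  p \in simple_paths w -> p \in simple_paths w' -> w = w'.
Proof.
rewrite !inE => /and3P[/eqP h1 k1 _] /and3P[/eqP h2 k2 _].
case: w w' h1 k1 h2 k2 => [i j] [i' j'] /= <- k1 <- k2.
by rewrite (walk_inj k1 k2).
Qed.

End Paths.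

(** * The potential and its subgradients, equilibria, and the repaired flow *)

Section StableDynamics.
Variables (R : realType) (net : network R).
Local Notation E := (edge (graph net)).
Local Notation evec := (vec R E).
Local Notation tbar := (tbar net).
Local Notation fbar := (fbar net).
Implicit Types (t v f g : evec).

Lemma Tpath_inner t p : Tpath t p = inner (path_vec p) t.
Proof.
rewrite /Tpath big_mkcond.
rewrite /inner; apply: eq_bigr => e _; rewrite ffunE /Theta; by case: (e \in _); rewrite ?mul1r ?mul0r.
Qed.

(** A convex combination of path times at [z] is at least their minimum. With [subdiff_Phi_eq],
    where the paths are shortest, this is the subgradient inequality freed of its constant term. *)
Lemma subdiff_Phi_le t v z : subdiff_Phi t v -> inner v z <= Phi z.
Proof.
move=> [c [cc ->]]; rewrite innerNl inner_suml lerN2.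
apply: ler_sum => w wO; rewrite innerZl; apply: ler_wpM2l; first exact: demand_ge0.
have [lam [lam0 lam1 ->]] := cc w wO; rewrite inner_suml.
rewrite -[leLHS]mul1r -lam1 mulr_suml; apply: ler_sum => p pA.
rewrite innerZl; apply: ler_wpM2l; first exact: lam0.
have: p \in simple_paths w by move: pA; rewrite inE => /andP[].
by move=> pw; rewrite -(Tpath_inner z p) fin_min_le.
Qed.

Lemma subdiff_Phi_eq t v : subdiff_Phi t v -> inner v t = Phi t.
Proof.
move=> [c [cc ->]]; rewrite innerNl inner_suml; congr (- _).
apply: eq_bigr => w wO; rewrite innerZl; congr (_ * _).
have [lam [lam0 lam1 ->]] := cc w wO; rewrite inner_suml.
rewrite -[RHS]mul1r -lam1 mulr_suml; apply: eq_bigr => p.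
by rewrite inE => /andP[pw /eqP <-]; rewrite innerZl (Tpath_inner t p).
Qed.

(** The convex weights of each pair, scaled by its demand, are path flows that load the edges with
    [- v]. *)
Lemma subdiff_Phi_flow t v : subdiff_Phi t v -> is_flow (- v).
Proof.
move=> [c [cc ->]]; rewrite opprK.
have /choice [lam lamP] : forall w, exists lam, w \in OD net ->
    [/\ forall p, p \in shortest_paths t w -> 0 <= lam p,
        \sum_(p in shortest_paths t w) lam p = 1
      & c w = \sum_(p in shortest_paths t w) lam p *: path_vec p].
  move=> w; case wO: (w \in OD net); last by exists (fun=> 0).
  by have [lam ?] := cc w wO; exists lam.
(* By disjointness of the path sets, at most one [w] contributes to the sum. *)
pose x : vec R (gpath (graph net)) :=
  [ffun p => \sum_(w in OD net | p \in shortest_paths t w) demand net w * lam w p].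
have xE w p : w \in OD net -> p \in simple_paths w ->
    x p = if p \in shortest_paths t w then demand net w * lam w p else 0.
  move=> wO pw; rewrite ffunE.
  have other w' : w' != w -> (p \in shortest_paths t w') = false.
    move=> ww'; rewrite inE; apply/negP => /andP[pw' _].
    by rewrite (simple_paths_inj pw' pw) eqxx in ww'.
  rewrite big_mkcond (bigD1 w) //= big1 ?addr0 => [|w' /other ->].
    by rewrite wO; case: (p \in _).
  by rewrite andbF.
have sub w p : p \in shortest_paths t w -> p \in simple_paths w.
  by rewrite inE => /andP[].
exists x; split; first split.
- move=> p /bigcupP[w wO pw]; rewrite (xE w) //; case: ifP => // ps.
  by have [lam0 _ _] := lamP w wO; rewrite mulr_ge0 ?demand_ge0 ?lam0.
- move=> w wO; have [_ lam1 _] := lamP w wO.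
  rewrite -[RHS]mulr1 -lam1 mulr_sumr.
  rewrite (eq_bigr _ (fun p pw => xE w p wO pw)) -big_mkcondr.
  by apply: eq_bigl => p; rewrite andb_idl // => /sub.
apply/ffunP => e; rewrite sum_ffunE [RHS]ffunE.
transitivity (\sum_(w in OD net) \sum_(p in shortest_paths t w)
    Theta e p * (demand net w * lam w p) : R).
  apply: eq_bigr => w wO; have [_ _ ->] := lamP w wO.
  rewrite ffunE sum_ffunE scaler_sumr; apply: eq_bigr => p _.
  by rewrite !ffunE /GRing.scale /=; ring.
rewrite (exchange_big_dep (mem (OD_paths net))) /= => [|w p wO /sub pw].
  by apply: eq_bigr => p _; rewrite ffunE mulr_sumr.
by apply/bigcupP; exists w.
Qed.

Lemma lagrangianE f t : lagrangian f t = Psi f + inner (t - tbar) (f - fbar).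
Proof.
rewrite /lagrangian /Psi /inner -big_split; apply: eq_bigr => e _ /=.
rewrite !ffunE; move: (t e : R) (f e : R) (tbar e : R) (fbar e : R) => a b c d.
by rewrite -[a - c]/(a - c : R) -[b - d]/(b - d : R); ring.
Qed.

Lemma PsiE f : Psi f = inner f tbar. Proof. by []. Qed.

Lemma hE t : h t = inner (t - tbar) fbar. Proof. by []. Qed.

(** The Lagrangian is affine in the flow. Bounds for individual flows thus pass to their average,
    and the average need not be shown to be a flow. *)
Lemma lagrangian_comb (I : Type) (s : seq I) (lam : I -> R) (F : I -> evec) t c :
  (forall i, 0 <= lam i) -> \sum_(i <- s) lam i = 1 ->
  (forall i, c <= lagrangian (F i) t) -> c <= lagrangian (\sum_(i <- s) lam i *: F i) t.
Proof.
move=> l0 l1 Fc; have -> : lagrangian (\sum_(i <- s) lam i *: F i) t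
    = \sum_(i <- s) lam i * lagrangian (F i) t.
  under [RHS]eq_bigr do rewrite lagrangianE PsiE innerBr addrA mulrBr.
  rewrite sumrB -mulr_suml l1 mul1r lagrangianE PsiE innerBr addrA; congr (_ - _).
  rewrite !(innerC (t - tbar)) -innerDr inner_suml; apply: eq_bigr => i _.
  by rewrite innerZl (innerC _ (F i)) innerDr.
rewrite -[leLHS]mul1r -l1 mulr_suml; apply: ler_sum => i _.
by apply: ler_wpM2l.
Qed.

(** At [tbar] the penalty vanishes, so [Psi f = lagrangian f tbar <= lagrangian f t <= lagrangian g
    t] by the two saddle inequalities. *)
Lemma equilibrium_Psi_le f g t : equilibrium f t -> is_flow g -> Psi f <= lagrangian g t.
Proof.
move=> [_ tt ft gt] /gt; apply: le_trans; apply: le_trans (ft tbar (fun=> lexx _)).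
by rewrite lagrangianE subrr -(scale0r 0) innerZl mul0r addr0.
Qed.

Lemma max_load_ge f e : (f e : R) <= (1 + excess f) * fbar e.
Proof.
rewrite -ler_pdivrMr ?fbar_gt0 // addrCA subrr addr0.
by apply: (@le_fin_max _ _ _ (fun e => (f e : R) / fbar e)); rewrite inE.
Qed.

Lemma max_load_attained f (e0 : E) : exists e, (f e : R) - fbar e = excess f * fbar e.
Proof.
have [e _ h] := fin_maxP (fun e => (f e : R) / fbar e) (in_setT e0).
exists e; rewrite /excess /max_load h mulrBl mul1r divfK // gt_eqF // fbar_gt0 //.
Qed.

(** Nonnegative slack means [g <= fbar], so the penalty in [lagrangian g t] is nonpositive for
    [t >= tbar]. *)
Lemma equilibrium_slack_Psi_le f g t : equilibrium f t -> is_flow g -> 0 <= slack g ->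
  Psi f <= Psi g.
Proof.
move=> eq gf sg; apply: le_trans (equilibrium_Psi_le eq gf) _.
have [_ /vle_subr tt _ _] := eq; rewrite lagrangianE gerDl.
have := inner_mono tt (_ : vle g fbar); rewrite innerBr subr_le0; apply => e.
apply: le_trans (max_load_ge g e) _; rewrite ger_pMl ?fbar_gt0 //.
by rewrite /excess; rewrite /slack in sg; lra.
Qed.

Lemma min_capacity_le e : min_capacity net <= fbar e.
Proof. by apply: (@fin_min_le _ _ _ (fun e => fbar e : R)); rewrite inE. Qed.

Lemma min_capacity_gt0 (e0 : E) : 0 < min_capacity net.
Proof.
have [e _ h] := fin_minP (fun e => fbar e : R) (in_setT e0).
by rewrite /min_capacity h fbar_gt0.
Qed.

(* Test the bound of the hypothesis at [s = theta (t - tbar) + b delta_e], with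
   [e] the most overloaded edge: the first term turns the saddle-point
   inequality for [fhat] into [Psi fstar <= Psi fhat + ...], the second one pays
   for the distance of [g] to optimality. *)
Lemma proj_admissible_gap (f t fh g : evec) (q A eps : R) :
  equilibrium f t -> is_flow g -> 0 < slack g -> 0 < l2norm (t - tbar) -> 0 < A ->
  Psi f <= lagrangian fh t ->
  (forall s : evec, vle 0 s ->
     q + Psi fh <= l2norm s ^+ 2 / (2 * A) - inner (fh - fbar) s + eps) ->
  q + Psi (proj_admissible g fh) <=
    2 * l2norm (t - tbar) ^+ 2
      * Num.max 1 ((inner (g - f) tbar
                   / (slack g * l2norm (t - tbar) * min_capacity net)) ^+ 2) / A + eps.
Proof.
move=> eq gf sg r0 A0 ffh Hs; set r := l2norm _; set K := Num.max _ _.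
have K1 : 1 <= K by rewrite le_max lexx.
rewrite /proj_admissible; case: ifPn => [_|].
  (* An admissible [fh] is left unchanged, and [s = 0] suffices. *)
  have := Hs 0 (fun=> lexx _); rewrite l2normE -(scale0r 0) !innerZr innerZl !mul0r subr0 add0r.
  move=> h; apply: le_trans h _; rewrite lerDr.
  by rewrite !mulr_ge0 ?sqr_ge0 ?(le_trans _ K1) ?invr_ge0 // ltW.
rewrite -ltNge; set n := excess fh; set x := slack g => n0.
(* Without edges the norm [r] would be 0; an edge is needed because [fin_max] and [fin_min] are junk
   on the empty set. *)
have [e0 _|e0] := pickP (@predT E); last first.
  by move: r0; rewrite /r /l2norm big_pred0 ?sqrtr0 ?ltxx.
have [e he] := max_load_attained fh e0.
have m0 := min_capacity_gt0 e0.
have me := min_capacity_le e; set m := min_capacity net in m0 me *.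
set D := inner (g - f) tbar.
have D0 : 0 <= D by rewrite /D innerBl -!PsiE subr_ge0 (equilibrium_slack_Psi_le eq) // ltW.
(* The weight of [g] in the repaired flow. *)
pose th := n / (x + n).
have xn : 0 < x + n by rewrite addr_gt0.
have th0 : 0 <= th by rewrite divr_ge0 ?ltW.
have th1 : th <= 1 by rewrite ler_pdivrMr // mul1r lerDr ltW.
(* The edge [e] is overloaded by [n * fbar e], and [b] is chosen so that
   [b * (n * fbar e) = th * D]. *)
have f0 := fbar_gt0 e; pose b := D / ((x + n) * fbar e).
have b0 : 0 <= b by rewrite divr_ge0 // ltW // mulr_gt0.
pose s : evec := th *: (t - tbar) + b *: [ffun i => (i == e)%:R].
have [_ /vle_subr tt _ _] := eq.
have s0 : vle 0 s.
  move=> i; have := tt i; rewrite !ffunE /GRing.scale /= => ti.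
  by rewrite addr_ge0 // mulr_ge0 // ler0n.
have de u : inner u [ffun i => (i == e)%:R] = u e.
  rewrite /inner (bigD1 e) //= ffunE eqxx mulr1 big1 ?addr0 // => i /negPf ie.
  by rewrite ffunE ie mulr0.
(* Both parts of [s] have squared norm at most [r ^+ 2 * K]: the first because [th ^+ 2 <= 1 <= K],
   the second because [x * m <= (x + n) * fbar e]. *)
have sn : l2norm s ^+ 2 <= 4 * r ^+ 2 * K.
  pose k := D / (x * r * m).
  have Kk : k ^+ 2 <= K by rewrite le_max; apply/orP; right; exact: lexx.
  have bk : b <= k * r.
    have -> : k * r = D / (x * m) by rewrite /k; field; rewrite !gt_eqF.
    rewrite /b ler_wpM2l // lef_pV2 ?posrE ?mulr_gt0 //.
    by apply: ler_pM; rewrite ?lerDl ?(ltW sg) ?(ltW m0) ?(ltW n0).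
  have b2 : b ^+ 2 <= K * r ^+ 2.
    apply: le_trans (_ : (k * r) ^+ 2 <= _); first by rewrite lerXn2r // nnegrE (le_trans b0 bk).
    by rewrite exprMn ler_wpM2r // sqr_ge0.
  have th2 : th ^+ 2 <= 1 by rewrite expr_le1.
  have r2 : 0 <= r ^+ 2 by rewrite sqr_ge0.
  have tr : th ^+ 2 * r ^+ 2 <= K * r ^+ 2 by rewrite ler_wpM2r // (le_trans th2).
  apply: le_trans (l2norm_sqrD _ _) _.
  rewrite !l2normE !(innerZl, innerZr) -l2normE -/r de ffunE eqxx mulr1; nra.
have is1 : inner (fh - fbar) s = th * inner (t - tbar) (fh - fbar) + th * D.
  rewrite /s (innerDr (th *: _)) !innerZr de (innerC (fh - fbar)); congr (_ + _).
  rewrite !ffunE -[fh e - fbar e]/((fh e : R) - fbar e) he -/n /b /th; field.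
  by rewrite !gt_eqF.
have := Hs s s0; rewrite is1 => h.
have PE : Psi ((x + n)^-1 *: (x *: fh + n *: g)) = Psi fh + th * (Psi g - Psi fh).
  rewrite !PsiE innerZl innerDl !innerZl /th; field; by rewrite gt_eqF.
rewrite PE; rewrite lagrangianE in ffh.
have DE : D = Psi g - Psi f by rewrite /D innerBl.
have h2 : th * (Psi g - Psi fh) <= th * D + th * inner (t - tbar) (fh - fbar).
  by rewrite -mulrDr ler_wpM2l // DE; lra.
have h3 : l2norm s ^+ 2 / (2 * A) <= 2 * r ^+ 2 * K / A.
  rewrite ler_pdivrMr ?mulr_gt0 //.
  have -> : 2 * r ^+ 2 * K / A * (2 * A) = 4 * r ^+ 2 * K by field; rewrite gt_eqF.
  by [].
lra.
Qed.
End StableDynamics.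

(** * The quadratic equation of the step size *)

Section StepSize.
Variables (R : realType) (L A a b : R).
Hypotheses (L0 : 0 < L) (A0 : 0 <= A) (b0 : 0 < b).

Lemma step_size_root : a = (2 * L)^-1 + Num.sqrt ((4 * L ^+ 2)^-1 + A / L) ->
  0 < a /\ L * a ^+ 2 = A + a.
Proof.
move=> ->; set q := _ + A / L; set s := Num.sqrt q.
have q0 : 0 <= q.
  by rewrite addr_ge0 ?invr_ge0 ?divr_ge0 ?mulr_ge0 ?sqr_ge0 // ltW.
have s2 : s ^+ 2 = q by rewrite sqr_sqrtr.
have i0 : 0 < (2 * L)^-1 by rewrite invr_gt0 mulr_gt0.
split; first by rewrite ltr_pwDl // sqrtr_ge0.
have -> : L * ((2 * L)^-1 + s) ^+ 2 = (4 * L)^-1 + s + L * s ^+ 2.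
  by field; rewrite gt_eqF.
by rewrite s2 /q; field; rewrite gt_eqF.
Qed.

Hypotheses (a0 : 0 < a) (aE : L * a ^+ 2 = A + a).

Lemma step_size_ge1 : 1 <= L * a.
Proof. by rewrite -(ler_pM2r a0) -mulrA -expr2 aE mul1r lerDr. Qed.

(** [a] is a root of [L x^2 - x - A], and for [b > 0] the cofactor is positive by [step_size_ge1].
    The sign of the quadratic at [b] therefore tells on which side of [a] it lies. *)
Lemma step_size_factor : L * b ^+ 2 - (A + b) = (b - a) * (L * a - 1 + L * b).
Proof. by rewrite -[A](addrK a) -aE; ring. Qed.

Lemma le_step_size : L * b ^+ 2 <= A + b -> b <= a.
Proof.
rewrite -subr_le0 step_size_factor pmulr_lle0 ?subr_le0 //.
by rewrite ltr_wpDl ?mulr_gt0 // subr_ge0 step_size_ge1.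
Qed.

Lemma step_size_le : A + b <= L * b ^+ 2 -> a <= b.
Proof.
rewrite -subr_ge0 step_size_factor pmulr_lge0 ?subr_ge0 //.
by rewrite ltr_wpDl ?mulr_gt0 // subr_ge0 step_size_ge1.
Qed.
End StepSize.

(** The shift by an arbitrary [z] lets one identity serve both [h] ([z = tbar]) and the
    linearization ([z = y]). *)
Lemma vector_comb (R : realType) (I : finType) (a A A' : R) (u t t' : vec R I) z :
  A' = A + a -> 0 < A' -> t' = A'^-1 *: (a *: u + A *: t) ->
  A' *: (t' - z) = A *: (t - z) + a *: (u - z).
Proof.
move=> -> A0 ->; rewrite scalerBr scalerA divff ?gt_eqF // scale1r !scalerBr scalerDl.
by rewrite opprD (addrC (a *: u)) addrACA.
Qed.

(** * One UMST iteration: invariants, acceptance and step sizes *)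

Section UMST.
Variables (R : realType) (net : network R).
Local Notation E := (edge (graph net)).
Local Notation evec := (vec R E).
Local Notation tbar := (tbar net).
Local Notation fbar := (fbar net).
Local Notation M := (Mconst net).
Local Notation dom := (@dom_h R net).
Variables (nabla : evec -> evec) (L0 eps : R).
Hypothesis nablaP : subgradient_choice nabla.
Hypothesis boundM : subgradient_bound net.
Hypothesis eps0 : 0 < eps.
Hypothesis L00 : 0 < L0.
Hypothesis L0M : L0 <= 4 * M ^+ 2 / eps.

Local Notation trial := (umst_trial nabla).
Local Notation accept := (umst_accept nabla eps).
Local Notation lin := (linearization nabla).

(** The range allowed for [L0] would be empty if [M] were 0. *)
Lemma M2_gt0 : 0 < M ^+ 2.
Proof.
have := lt_le_trans L00 L0M; rewrite pmulr_lgt0 ?invr_gt0 //; lra.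
Qed.

Lemma M_neq0 : M != 0.
Proof. by rewrite -sqrf_eq0 gt_eqF // M2_gt0. Qed.

Lemma dom_ge0 t : dom t -> vle 0 t.
Proof. by move=> dt e; rewrite ffunE (le_trans _ (dt e)) // ltW ?tbar_gt0. Qed.

Lemma linE y t : dom y -> lin y t = inner (nabla y) t.
Proof.
move=> /dom_ge0 /nablaP sy.
by rewrite /linearization innerBr (subdiff_Phi_eq sy) addrC subrK.
Qed.

Lemma lin_le y t : dom y -> lin y t <= Phi t.
Proof. by move=> dy; rewrite linE //; apply: subdiff_Phi_le (nablaP (dom_ge0 dy)). Qed.

(* A bounded variation of subgradients is the case nu = 0 of a Hölder gradient:
   by Young's inequality it yields the quadratic upper model of Phi up to the
   error M^2 / (2 L), for every L. *)
Lemma Phi_le_model (L : R) y t : 0 < L -> dom y -> dom t ->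
  Phi t <= lin y t + L / 2 * l2norm (t - y) ^+ 2 + M ^+ 2 / (2 * L).
Proof.
move=> L_gt0 dy dt; have sy := nablaP (dom_ge0 dy); have st := nablaP (dom_ge0 dt).
have st_y := subdiff_Phi_le y st; rewrite linE // -(subdiff_Phi_eq st).
set d := t - y; set w := nabla t - nabla y.
have wM : inner w w <= M ^+ 2.
  have wM := boundM (dom_ge0 dt) (dom_ge0 dy) st sy.
  by rewrite -l2normE lerXn2r // nnegrE ?l2norm_ge0 // (le_trans (l2norm_ge0 _) wM).
have wd := inner_young w d L_gt0.
have : inner w w / (2 * L) <= M ^+ 2 / (2 * L).
  by rewrite ler_wpM2r // invr_ge0 mulr_ge0 // ltW.
have := wd; rewrite {1}/w {1}/d innerBl !innerBr (subdiff_Phi_eq sy); lra.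
Qed.

Lemma dom_tbar : dom tbar. Proof. by move=> e; apply: lexx. Qed.

(** [G] is the accumulated sum of [alpha_k nabla(y_k)]. The closed form of [phi_ s] persists because
    every linearization is a linear form. *)
Definition umst_inv (s : umst_state net) (G : evec) : Prop :=
  [/\ 0 < L_ s, 0 <= A_ s, dom (t_ s), is_argmin dom (phi_ s) (u_ s)
    & forall t, phi_ s t = l2norm (t - tbar) ^+ 2 / 2 + inner G t + A_ s * h t].

Lemma umst_inv_init : umst_inv (umst_init net L0) 0.
Proof.
split=> /=; [exact: L00|exact: lexx|exact: dom_tbar| |]; last first.
  by move=> t; rewrite mul0r -(scale0r 0) innerZl mul0r !addr0.
split=> [|z _]; first exact: dom_tbar.
by rewrite !l2normE subrr -(scale0r 0) innerZl mul0r mul0r divr_ge0 ?inner_ge0.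
Qed.

Lemma trial_exists s G L : umst_inv s G -> 0 < L -> exists s', trial s L s'.
Proof.
move=> [_ A0 dt [du _] phiE] L_gt0.
pose a := (2 * L)^-1 + Num.sqrt ((4 * L ^+ 2)^-1 + A_ s / L).
have [a0 _] := step_size_root L_gt0 A0 (erefl a).
pose A' := A_ s + a; have A'0 : 0 < A' by rewrite ltr_wpDl.
pose y := A'^-1 *: (a *: u_ s + A_ s *: t_ s).
have dy : dom y by apply: vle_comb; rewrite // ?(ltW a0) // /A' addrC.
pose phi t := phi_ s t + a * (lin y t + h t).
(* All linear terms of the new [phi], those of [h] included, gathered around [tbar] so that
   [box_min] applies. *)
pose H := G + a *: nabla y + A' *: fbar.
have phiE' t : phi t = l2norm (t - tbar) ^+ 2 / 2 + inner H (t - tbar)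
                       + inner (G + a *: nabla y) tbar.
  rewrite /phi phiE linE // hE /H !(innerDl, innerDr, innerNl, innerNr, innerZl, innerZr).
  by rewrite !(innerC _ fbar) /A'; ring.
pose u := box_min_pt tbar H.
have um : is_argmin dom phi u.
  have [uc umin] := box_min tbar H; split=> // z dz.
  by rewrite !phiE' lerD2r umin.
exists (UmstState L a A' y phi u (A'^-1 *: (a *: u + A_ s *: t_ s))).
by do 6 (split=> //).
Qed.

Lemma trial_inv s G L s' : umst_inv s G -> 0 < L -> trial s L s' ->
  [/\ umst_inv s' (G + alpha_ s' *: nabla (y_ s')), dom (y_ s'),
      0 < alpha_ s', A_ s' = A_ s + alpha_ s' & L_ s' * alpha_ s' ^+ 2 = A_ s'].
Proof.
move=> [_ A0 dt [du _] phiE] L_gt0 [LE [aE [AE [yE [pE [uE tE]]]]]].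
have [a0 ea] := step_size_root L_gt0 A0 aE.
have A'0 : 0 < A_ s' by rewrite AE ltr_wpDl.
have dy : dom (y_ s') by rewrite yE; apply: vle_comb; rewrite // ?(ltW a0) // AE addrC.
split=> //; last by rewrite LE ea AE.
split=> //; first by rewrite LE.
  by rewrite ltW.
  by rewrite tE; apply: vle_comb; rewrite // ?(ltW a0) // ?AE 1?addrC //; case: uE.
by move=> t; rewrite pE phiE linE // !innerDl !innerZl AE; ring.
Qed.

(** Since [L * alpha ^+ 2 = A], the tolerance [alpha / (2 * A) * eps] equals
    [eps / alpha / (2 * L)], which dominates the model error [M ^+ 2 / (2 * L)] of
    [Phi_le_model]. *)
Lemma trial_accept s G L s' : umst_inv s G -> 0 < L -> trial s L s' ->
  M ^+ 2 * alpha_ s' <= eps -> accept s'.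
Proof.
move=> inv L_gt0 tr Ma; have [[L'0 _ dt' _ _] dy' a0 _ LE] := trial_inv inv L_gt0 tr.
apply: le_trans (Phi_le_model L'0 dy' dt') _; rewrite lerD2l -LE.
have -> : alpha_ s' / (2 * (L_ s' * alpha_ s' ^+ 2)) * eps
          = eps / alpha_ s' / (2 * L_ s').
  by field; rewrite !gt_eqF.
apply: ler_wpM2r; last by rewrite ler_pdivlMr.
by rewrite invr_ge0 mulr_ge0 // ltW.
Qed.

Definition umst_gap (s : umst_state net) : Prop :=
  A_ s * Q (t_ s) <= phi_ s (u_ s) + A_ s * eps / 2.

(** Strong convexity of [phi_ s] gains half the squared distance from [u_ s] to [u_ s']. This
    exactly pays for the quadratic term of the acceptance test, by similar triangles and
    [L * alpha ^+ 2 = A]; the tolerance adds [alpha * eps / 2]. *)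
Lemma accept_gap s G L s' : umst_inv s G -> 0 < L -> trial s L s' -> accept s' ->
  umst_gap s -> umst_gap s'.
Proof.
move=> inv L_gt0 tr acc gap; have [inv' dy a0 AE LE] := trial_inv inv L_gt0 tr.
have [_ A0 dt um phiE] := inv; have [L'0 _ dt' [du' _] _] := inv'.
have A'0 : 0 < A_ s' by rewrite AE ltr_wpDl.
have [_ [_ [_ [yE [pE [_ tE]]]]]] := tr.
have comb z := vector_comb z AE A'0 tE.
have sc : phi_ s (u_ s) + l2norm (u_ s' - u_ s) ^+ 2 / 2 <= phi_ s (u_ s').
  apply: (argmin_strong_convexity (b := tbar) (G := G + A_ s *: fbar)
    (k := - A_ s * inner tbar fbar)) um du' => t.
  by rewrite phiE hE innerBl innerDl innerZl (innerC fbar); ring.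
have ty : A_ s' *: (t_ s' - y_ s') = alpha_ s' *: (u_ s' - u_ s).
  rewrite yE tE scalerBr !scalerA divff ?gt_eqF // !scale1r.
  by rewrite opprD addrACA subrr addr0 scalerBr.
have nty : A_ s' ^+ 2 * l2norm (t_ s' - y_ s') ^+ 2
           = alpha_ s' ^+ 2 * l2norm (u_ s' - u_ s) ^+ 2.
  by rewrite -!l2normZ_sqr ty.
have nE : A_ s' * L_ s' * l2norm (t_ s' - y_ s') ^+ 2 = l2norm (u_ s' - u_ s) ^+ 2.
  apply: (mulfI (_ : alpha_ s' ^+ 2 != 0)); first by rewrite gt_eqF // exprn_gt0.
  rewrite -nty -[in RHS]LE -{1}LE; ring.
have hc : A_ s' * h (t_ s') = A_ s * h (t_ s) + alpha_ s' * h (u_ s').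
  by rewrite !hE -!innerZl comb innerDl.
have lc : A_ s' * lin (y_ s') (t_ s')
          = A_ s * lin (y_ s') (t_ s) + alpha_ s' * lin (y_ s') (u_ s').
  by rewrite /linearization !mulrDr -!innerZr comb innerDr AE; ring.
(* The linearization at the old point [t_ s] is replaced by [Phi (t_ s)], where the previous gap
   enters. *)
have lt := ler_wpM2l A0 (lin_le (t_ s) dy).
have := acc; rewrite /umst_accept -(ler_pM2l A'0) 2!mulrDr lc.
have -> : A_ s' * (alpha_ s' / (2 * A_ s') * eps) = alpha_ s' * eps / 2.
  by field; rewrite gt_eqF.
have -> : A_ s' * (L_ s' / 2 * l2norm (t_ s' - y_ s') ^+ 2) = l2norm (u_ s' - u_ s) ^+ 2 / 2.
  by rewrite -nE; field.
move: gap; rewrite /umst_gap /Q (mulrDr _ (Phi (t_ s))) (mulrDr _ (Phi (t_ s'))) hc pE AE; lra.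
Qed.

(** Half the threshold [eps / M ^+ 2] of [trial_accept]. *)
Local Notation beta := (eps / (2 * M ^+ 2)).

Lemma beta_gt0 : 0 < beta.
Proof. by rewrite divr_gt0 // mulr_gt0 // M2_gt0. Qed.

(* Guarantees [alpha >= beta] for the trial value [L / 2]. *)
Definition umst_Lbound (s : umst_state net) : Prop :=
  L_ s * beta ^+ 2 <= 2 * (A_ s + beta).

(** If the first trial is accepted, [umst_Lbound] applies. Otherwise the trial with half the [L] was
    rejected, so its step exceeded [2 * beta], and doubling [L] at most halves the step. *)
Lemma step_alpha_ge s G s' : umst_inv s G -> umst_Lbound s -> umst_step nabla eps s s' ->
  beta <= alpha_ s'.
Proof.
move=> inv Lb [i [tr _ rej]]; have b0 := beta_gt0.
have [Ls A0 _ _ _] := inv.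
have L'0 n : 0 < 2 ^+ n * (L_ s / 2) by rewrite mulr_gt0 ?exprn_gt0 ?divr_gt0.
have [_ _ a0 AE] := trial_inv inv (L'0 i) tr.
have -> : L_ s' = 2 ^+ i * (L_ s / 2) by case: tr.
rewrite AE => LE; apply: (le_step_size (L'0 i) A0 b0 a0 LE).
case: i => [|i] in tr rej LE *; first by rewrite /umst_Lbound in Lb; rewrite mul1r; lra.
have [s'' [tr'' nacc]] := rej i (ltnSn i).
have [_ _ a''0 AE''] := trial_inv inv (L'0 i) tr''.
have -> : L_ s'' = 2 ^+ i * (L_ s / 2) by case: tr''.
rewrite AE''.
have : 2 * beta < alpha_ s''.
  rewrite ltNge; apply: contra nacc => le; apply: (trial_accept inv (L'0 i) tr'').
  have -> : eps = M ^+ 2 * (2 * beta) by field; exact: M_neq0.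
  by rewrite ler_wpM2l // ltW // M2_gt0.
rewrite (exprS 2) -(mulrA 2); move: (2 ^+ i * _) (alpha_ s'') a''0 (L'0 i) => K c c0 K0 bc KE.
(* Multiplying by [c ^+ 2] eliminates [K] through [K * c ^+ 2 = A_ s + c]; the rest follows from
   [2 * b < c]. *)
rewrite -(ler_pM2r (exprn_gt0 2 c0)).
have -> : 2 * K * beta ^+ 2 * c ^+ 2 = 2 * beta ^+ 2 * (A_ s + c) by rewrite -KE; ring.
move: beta b0 bc => b b0 bc.
have h1 : 2 * b ^+ 2 * A_ s <= c ^+ 2 * A_ s by rewrite ler_wpM2r //; nra.
have h2 : 2 * b ^+ 2 * c <= b * c ^+ 2.
  have -> : 2 * b ^+ 2 * c = (b * c) * (2 * b) by ring.
  have -> : b * c ^+ 2 = (b * c) * c by ring.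
  by rewrite ler_pM2l ?(ltW bc) // mulr_gt0.
by rewrite mulrDr; lra.
Qed.

Lemma step_props s G s' : umst_inv s G -> umst_Lbound s -> umst_gap s ->
  umst_step nabla eps s s' ->
  [/\ umst_inv s' (G + alpha_ s' *: nabla (y_ s')), umst_Lbound s', umst_gap s',
      dom (y_ s') & A_ s' = A_ s + alpha_ s' /\ beta <= alpha_ s'].
Proof.
move=> inv Lb gap st; have ba := step_alpha_ge inv Lb st; have b0 := beta_gt0.
have [i [tr acc _]] := st; have [Ls A0 _ _ _] := inv.
have L'0 : 0 < 2 ^+ i * (L_ s / 2) by rewrite mulr_gt0 ?exprn_gt0 ?divr_gt0.
have [inv' dy a0 AE LE] := trial_inv inv L'0 tr.
split=> //; last exact: accept_gap inv L'0 tr acc gap.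
have [L0' _ _ _ _] := inv'.
(* [L * alpha ^+ 2 = A] and [beta <= alpha] give more than the next [umst_Lbound] asks. *)
have : L_ s' * beta ^+ 2 <= A_ s'.
  by rewrite -LE ler_pM2l // lerXn2r // nnegrE ltW.
rewrite /umst_Lbound; lra.
Qed.

(** Doubling [L] eventually brings the step below [2 * beta], where acceptance is certain; the least
    accepted index has only rejections before it. *)
Lemma step_exists s G : umst_inv s G -> exists s', umst_step nabla eps s s'.
Proof.
move=> inv; have [Ls A0 _ _ _] := inv.
have L'0 n : 0 < 2 ^+ n * (L_ s / 2) by rewrite mulr_gt0 ?exprn_gt0 ?divr_gt0.
have /choice [f fP] : forall n, exists s', trial s (2 ^+ n * (L_ s / 2)) s'.
  by move=> n; apply: trial_exists inv _.
have b0 := beta_gt0; pose c := 2 * beta.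
have c0 : 0 < c by rewrite mulr_gt0.
have ex : exists n, accept (f n).
  (* By [step_size_le], the step is at most [c] once [2 ^+ n >= B]. *)
  pose B := (A_ s + c) / (L_ s / 2 * c ^+ 2).
  have d0 : 0 < L_ s / 2 * c ^+ 2 by rewrite mulr_gt0 ?exprn_gt0 ?divr_gt0.
  have B0 : 0 <= B by rewrite (divr_ge0 _ (ltW d0)) // addr_ge0 // ltW.
  exists (Num.bound B); set n := Num.bound B.
  apply: (trial_accept inv (L'0 n) (fP n)).
  have -> : eps = M ^+ 2 * c by rewrite /c; field; exact: M_neq0.
  rewrite ler_pM2l ?M2_gt0 //.
  have [_ _ a0 AE] := trial_inv inv (L'0 n) (fP n).
  have -> : L_ (f n) = 2 ^+ n * (L_ s / 2) by case: (fP n).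
  rewrite AE => LE; apply: (step_size_le (L'0 n) A0 c0 a0 LE).
  rewrite -mulrA -ler_pdivrMr // -/B (le_trans (ltW (archi_boundP B0))) //.
  by rewrite -natrX ler_nat ltnW // ltn_expl.
case: (ex_minnP ex) => i acc mini; exists (f i), i; split=> // j ji.
exists (f j); split=> //; apply/negP => /mini; rewrite leqNgt ji //.
Qed.

(** With [A = 0] the bound reads [L0 <= 2 / beta], which is the assumed [4 * M ^+ 2 / eps]. *)
Lemma umst_Lbound_init : umst_Lbound (umst_init net L0).
Proof.
have b0 := beta_gt0; rewrite /umst_Lbound /= add0r expr2 mulrA ler_pM2r //.
rewrite mulrA ler_pdivrMr; last by rewrite mulr_gt0 ?M2_gt0.
by move: L0M; rewrite ler_pdivlMr //; lra.
Qed.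

Lemma umst_gap_init : umst_gap (umst_init net L0).
Proof. by rewrite /umst_gap /= !mul0r addr0 divr_ge0 // sqr_ge0. Qed.

Lemma umst_run_exists : exists S, umst_run nabla L0 eps S.
Proof.
(* On states satisfying the invariants a next state always exists and stays in [T], so a choice
   function can be iterated. *)
pose T := {s | exists G, [/\ umst_inv s G, umst_Lbound s & umst_gap s]}.
have /choice [f fP] : forall s : T, exists s' : T, umst_step nabla eps (sval s) (sval s').
  move=> [s [G [inv Lb gap]]]; have [s' st] := step_exists inv.
  have [inv' Lb' gap' _ _] := step_props inv Lb gap st.
  by exists (exist _ s' (ex_intro _ _ (And3 inv' Lb' gap'))).
pose s0 : T := exist _ _ (ex_intro _ _ (And3 umst_inv_init umst_Lbound_init umst_gap_init)).
by exists (fun k => sval (iter k f s0)); split=> // k /=.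
Qed.

(** * Primal and dual estimates along a whole run *)

Section Run.
Variable S : nat -> umst_state net.
Hypothesis run : umst_run nabla L0 eps S.

Definition grad_sum N : evec := \sum_(1 <= k < N.+1) alpha_ (S k) *: nabla (y_ (S k)).

Lemma run_inv k : [/\ umst_inv (S k) (grad_sum k), umst_Lbound (S k) & umst_gap (S k)].
Proof.
have [S0 Sk] := run; elim: k => [|k [inv Lb gap]].
  rewrite S0 /grad_sum big_nil; split; [exact: umst_inv_init|exact: umst_Lbound_init|].
  exact: umst_gap_init.
have [inv' Lb' gap' _ _] := step_props inv Lb gap (Sk k).
by rewrite /grad_sum big_nat_recr.
Qed.

Lemma run_step k : [/\ dom (y_ (S k.+1)), A_ (S k.+1) = A_ (S k) + alpha_ (S k.+1)
  & beta <= alpha_ (S k.+1)].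
Proof.
have [_ Sk] := run; have [inv Lb gap] := run_inv k.
by have [_ _ _ dy [AE ba]] := step_props inv Lb gap (Sk k).
Qed.

Lemma run_AE N : A_ (S N) = \sum_(1 <= k < N.+1) alpha_ (S k).
Proof.
elim: N => [|N IH]; first by rewrite big_nil; have [-> _] := run.
by have [_ -> _] := run_step N; rewrite big_nat_recr //= IH.
Qed.

Lemma run_A_ge N : N%:R * beta <= A_ (S N).
Proof.
elim: N => [|N IH]; first by rewrite mul0r; have [-> _] := run.
by have [_ -> ba] := run_step N; rewrite -natr1 mulrDl mul1r lerD.
Qed.

Lemma run_A_gt0 N : (1 <= N)%N -> 0 < A_ (S N).
Proof.
by move=> N1; apply: lt_le_trans (run_A_ge N); rewrite mulr_gt0 ?beta_gt0 ?ltr0n.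
Qed.

Lemma run_gap N z : dom z ->
  A_ (S N) * Q (t_ (S N)) <=
    l2norm (z - tbar) ^+ 2 / 2 + inner (grad_sum N) z + A_ (S N) * h z + A_ (S N) * eps / 2.
Proof.
move=> dz; have [[_ _ _ [_ um] phiE] _ gap] := run_inv N.
by apply: le_trans gap _; rewrite lerD2r -phiE um.
Qed.

Lemma grad_sum_le N z : inner (grad_sum N) z <= A_ (S N) * Phi z.
Proof.
rewrite run_AE mulr_suml inner_suml !big_add1 /=; apply: ler_sum => k _.
have [dy _ ba] := run_step k; rewrite innerZl ler_wpM2l ?(le_trans (ltW beta_gt0)) //.
exact: subdiff_Phi_le (nablaP (dom_ge0 dy)).
Qed.

Lemma run_dual N z : (1 <= N)%N -> dom z ->
  Q (t_ (S N)) - Q z <= l2norm (z - tbar) ^+ 2 / (2 * A_ (S N)) + eps / 2.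
Proof.
move=> N1 dz; have A0 := run_A_gt0 N1.
rewrite -(ler_pM2l A0).
have -> : A_ (S N) * (l2norm (z - tbar) ^+ 2 / (2 * A_ (S N)) + eps / 2)
   = l2norm (z - tbar) ^+ 2 / 2 + A_ (S N) * eps / 2 by field; rewrite gt_eqF.
have := run_gap N dz; have := grad_sum_le N z; rewrite -[Q z]/(Phi z + h z); lra.
Qed.

(** In the gap at [tbar + s], the linear form contributes [- A * Psi fhat] at [tbar], and this term
    moves to the left-hand side. *)
Lemma run_primal_dual N s : (1 <= N)%N -> vle 0 s ->
  Q (t_ (S N)) + Psi (fhat nabla S N) <=
    l2norm s ^+ 2 / (2 * A_ (S N)) - inner (fhat nabla S N - fbar) s + eps / 2.
Proof.
move=> N1 s0; have A0 := run_A_gt0 N1; set f := fhat _ _ _.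
have zs : tbar + s - tbar = s by rewrite addrC addKr.
have dz : dom (tbar + s) by apply/vle_subr; rewrite zs.
have GE : grad_sum N = - (A_ (S N) *: f).
  by rewrite /f /fhat scalerN opprK scalerA divff ?gt_eqF // scale1r.
have := run_gap N dz; rewrite hE GE zs.
rewrite innerNl innerZl innerDr -PsiE => gap; rewrite -(ler_pM2l A0).
have -> : A_ (S N) * (l2norm s ^+ 2 / (2 * A_ (S N)) - inner (f - fbar) s + eps / 2)
   = l2norm s ^+ 2 / 2 - A_ (S N) * inner (f - fbar) s + A_ (S N) * eps / 2.
  by field; rewrite gt_eqF.
rewrite innerBl (innerC fbar); lra.
Qed.

(** [fhat] averages the flows [- nabla (y_k)] with weights [alpha_k / A_N], and each of them
    satisfies the saddle inequality. *)
Lemma fhat_Psi_le N f t : (1 <= N)%N -> equilibrium f t ->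
  Psi f <= lagrangian (fhat nabla S N) t.
Proof.
move=> N1 eq; have A0 := run_A_gt0 N1.
have -> : fhat nabla S N = \sum_(1 <= k < N.+1) (alpha_ (S k) / A_ (S N)) *: - nabla (y_ (S k)).
  rewrite /fhat scaler_sumr -sumrN; apply: eq_bigr => k _.
  by rewrite scalerN scalerA mulrC.
rewrite !big_add1 /=; apply: lagrangian_comb.
- move=> k; have [_ _ ba] := run_step k.
  by rewrite divr_ge0 ?(le_trans (ltW beta_gt0) ba) // ltW.
- have AE := run_AE N; rewrite big_add1 /= in AE.
  by rewrite -mulr_suml -AE divff // gt_eqF.
move=> k; apply: equilibrium_Psi_le eq _; have [dy _ _] := run_step k.
exact: subdiff_Phi_flow (nablaP (dom_ge0 dy)).
Qed.

Lemma run_error_le N (a : R) : (1 <= N)%N -> 0 <= a ->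
  2 * (a * M ^+ 2 / eps ^+ 2) <= N%:R -> a / A_ (S N) <= eps.
Proof.
move=> N1 a0 le; have A0 := run_A_gt0 N1; rewrite ler_pdivrMr //.
have := run_A_ge N; rewrite -(ler_pM2l eps0); apply: le_trans.
have -> : a = eps * (2 * (a * M ^+ 2 / eps ^+ 2) * beta).
  by field; rewrite M_neq0 // gt_eqF.
by rewrite ler_pM2l // ler_wpM2r // ltW // beta_gt0.
Qed.
End Run.
End UMST.

(** * From the rates to the iteration counts *)

Theorem theorem3p6 (R : realType) :
  exists C : R, 0 < C /\
  forall (net : network R)
         (fstar tstar : vec R (edge (graph net)))
         (nabla : vec R (edge (graph net)) -> vec R (edge (graph net)))
         (eps L0 : R),
    equilibrium fstar tstar ->
    subgradient_choice nabla ->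
    subgradient_bound net ->
    0 < eps ->
    0 < L0 -> L0 <= 4 * Mconst net ^+ 2 / eps ->
    let M := Mconst net in
    let r := l2norm (tstar - tbar net) in
    (exists S : nat -> umst_state net, umst_run nabla L0 eps S) /\
    forall S : nat -> umst_state net, umst_run nabla L0 eps S ->
      holds_within (4 * (r * M / eps) ^+ 2)
        (fun N => Q (t_ (S N)) - Q tstar <= eps) /\
      (0 < r ->
       forall g : vec R (edge (graph net)),
         is_flow g -> 0 < slack g ->
         holds_within
           (C * ((r * M / eps) ^+ 2 *
                 Num.max 1
                   ((inner (g - fstar) (tbar net)
                     / (slack g * r * min_capacity net)) ^+ 2)))
           (fun N => Q (t_ (S N))
                     + Psi (proj_admissible g (fhat nabla S N)) <= eps)).
Proof.
(* The gap [2 * r ^+ 2 * K / A] has to be at most [eps / 2], so [run_error_le] is used with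
   [a = 4 * r ^+ 2 * K], and its factor 2 gives 8. *)
exists 8; split=> // net f t nabla eps L0 eq nP bM e0 L00 L0M M r.
have [_ dt _ _] := eq.
split; first exact: umst_run_exists nP bM e0 L00 L0M.
move=> S run; have err N a := run_error_le nP bM e0 L00 L0M run (N := N) (a := a).
split=> [|r0 g gf sg].
  apply: holds_within_ge => N N1 NK.
  apply: le_trans (run_dual nP bM e0 L00 L0M run N1 dt) _.
  rewrite -/r [leRHS]splitr lerD2r (mulrC 2) invfM mulrA ler_pM2r ?invr_gt0 //.
  apply: err => //; first by rewrite sqr_ge0.
  have -> : 2 * (r ^+ 2 * Mconst net ^+ 2 / eps ^+ 2) = 2 * (r * M / eps) ^+ 2.
    by rewrite /M; field; rewrite gt_eqF.
  by apply: le_trans NK; rewrite ler_wpM2r ?sqr_ge0 // ler_nat.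
apply: holds_within_ge => N N1; set K := Num.max _ _ => NK.
have K0 : 0 <= K by rewrite le_max ler01.
have := proj_admissible_gap eq gf sg r0 (run_A_gt0 nP bM e0 L00 L0M run N1)
  (fhat_Psi_le nP bM e0 L00 L0M run N1 eq)
  (fun s => run_primal_dual nP bM e0 L00 L0M run N1 (s := s)).
rewrite -/r -/K => h; apply: le_trans h _; rewrite [leRHS]splitr lerD2r.
rewrite ler_pdivlMr // mulrAC.
have r2K : 0 <= r ^+ 2 * K by rewrite mulr_ge0 ?sqr_ge0.
have -> : 2 * r ^+ 2 * K * 2 = 4 * (r ^+ 2 * K) by ring.
apply: err => //; first by rewrite mulr_ge0.
apply: le_trans NK; rewrite le_eqVlt; apply/orP; left; apply/eqP.
by rewrite /M; field; rewrite gt_eqF.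
Qed.
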